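(* Let $M$ be a metric space and $(a_n)_{n\in\mathbb N}$ a sequence of points of $M$. (a) The sequence is Cauchy if and only if the maps $\mathbb N^n\to M^n$, $(i_1,\dots,i_n)\mapsto(a_{i_1},\dots,a_{i_n})$ $(n\ge1)$, form a morphism $\bar a:\mathbb N^{\bullet}_{cof}\to M_{u}$ in $\mathrm{sFilt}$. (b) If the sequence is Cauchy, then it converges in $M$ if and only if $\bar a$ factors in $\mathrm{sFilt}$ as $\mathbb N^{\bullet}_{cof}\xrightarrow{\bar a_\infty}M_{u}[+1]\xrightarrow{[-1]}M_{u}$. Moreover, any such $\bar a_\infty$ is necessarily of the form $\mathbb N^n\to M^{n+1}$, $(i_1,\dots,i_n)\mapsto(a_\infty,a_{i_1},\dots,a_{i_n})$, where $a_\infty$ is the limit of the sequence $(a_n)$.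
   Context: A filter on a set $X$ is a collection of subsets of $X$, called neighbourhoods, closed under finite intersections (in particular containing $X$) and under passing to supersets; $\emptyset$ is allowed to be a neighbourhood and $X$ is allowed to be empty. A morphism of filters (a continuous map) is a function of the underlying sets such that the preimage of every neighbourhood is a neighbourhood. $\mathrm{Filt}$ is the category of filters. $\Delta$ is the category of finite linear orders $n_\le=\{0<\dots<n-1\}$, $n\ge 1$, and non-decreasing maps, and $\mathrm{sFilt}=\mathrm{Fun}(\Delta^{op},\mathrm{Filt})$ is the category of simplicial filters; a morphism in $\mathrm{sFilt}$ is a map of the underlying simplicial sets which is continuous at every level. Shift: $[+1]:\Delta\to\Delta$ adds a new minimal element (preserved by morphisms), and $X[+1]:=X\circ[+1]$, so $X[+1](n_\le)=X((n+1)_\le)$ as filters. The inclusions $n_\le\to (n+1)_\le$ omitting the new minimal element give a natural morphism $[-1]:X[+1]\to X$. For a metric space $M$, $M_{u}\in\mathrm{sFilt}$ has underlying simplicial set $n_\le\mapsto \mathrm{Hom}_{\mathrm{Sets}}(n,M)=M^n$, and $\varepsilon\subset M^n$ is a neighbourhood iff there is $\epsilon>0$ such that $(x_1,\dots,x_n)\in\varepsilon$ whenever $\mathrm{dist}(x_i,x_j)<\epsilon$ for all $i,j$. Thus $[-1]:M_{u}[+1]\to M_{u}$ is the projection $M\times M^n\to M^n$ forgetting the first coordinate. $\mathbb N^{\bullet}_{cof}\in\mathrm{sFilt}$ has underlying simplicial set $n_\le\mapsto\mathbb N^n$, where a subset of $\mathbb N^n$ is a neighbourhood iff it contains $\{(i_1,\dots,i_n):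 i_1,\dots,i_n>N\}$ for some $N$ (Cartesian powers of the filter of cofinite subsets of $\mathbb N$). *)

(* Defs.v *)
From mathcomp Require Import all_boot all_order all_algebra.
From mathcomp Require Import all_classical all_reals topology.

Set Implicit Arguments.
Unset Strict Implicit.
Unset Printing Implicit Defensive.

Import Order.TTheory GRing.Theory Num.Theory.

Local Open Scope classical_set_scope.
Local Open Scope ring_scope.

(* [Filter], unlike [ProperFilter], allows the empty set as a neighbourhood. *)
Record filt : Type := Filt {
  filt_sort :> Type;
  filt_nbhs : set_system filt_sort;
  filt_nbhsP : Filter filt_nbhs
}.

Record filtHom (X Y : filt) : Type := FiltHom {
  filtHom_fun :> X -> Y;
  filtHom_cont : forall A, filt_nbhs A -> filt_nbhs (filtHom_fun @^-1` A)
}.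

Lemma filtHom_ext (X Y : filt) (f g : filtHom X Y) : f =1 g -> f = g.
Proof.
case: f g => f fc [g gc] /= /funext fg.
by rewrite fg in fc *; congr FiltHom; exact: Prop_irrelevance.
Qed.

Definition filt_comp (X Y Z : filt) (g : filtHom Y Z) (f : filtHom X Y) :
  filtHom X Z :=
  @FiltHom X Z (g \o f) (fun A hA => filtHom_cont f (filtHom_cont g hA)).

(* The object n : nat stands for the nonempty finite linear order
   {0 < ... < n} = 'I_n.+1, that is, for (n+1)_<=. *)
Record deltaHom (m n : nat) : Type := DeltaHom {
  delta_fun :> 'I_m.+1 -> 'I_n.+1;
  delta_homo : forall i j : 'I_m.+1, (i <= j)%N -> (delta_fun i <= delta_fun j)%N
}.

Lemma deltaHom_ext (m n : nat) (f g : deltaHom m n) : f =1 g -> f = g.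
Proof.
case: f g => f fc [g gc] /= /funext fg.
by rewrite fg in fc *; congr DeltaHom; exact: Prop_irrelevance.
Qed.

Definition delta_id (n : nat) : deltaHom n n :=
  @DeltaHom n n id (fun _ _ => id).

Definition delta_comp (m n p : nat) (g : deltaHom n p) (f : deltaHom m n) :
  deltaHom m p :=
  @DeltaHom m p (g \o f) (fun i j ij => delta_homo g (delta_homo f ij)).

(* Fun(Delta^op, Filt), unfolded. The functor laws and naturality are stated
   pointwise since, by [filtHom_ext], morphisms of Filt with equal underlying
   functions are equal. *)
Record sFilt : Type := SFilt {
  sf_obj :> nat -> filt;
  sf_map : forall m n, deltaHom m n -> filtHom (sf_obj n) (sf_obj m);
  sf_map_id : forall n, sf_map (delta_id n) =1 id;
  sf_map_comp : forall m n p (g : deltaHom n p) (f : deltaHom m n),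
    sf_map (delta_comp g f) =1 sf_map f \o sf_map g
}.

Record sFiltHom (X Y : sFilt) : Type := SFiltHom {
  sfh_fun :> forall n, filtHom (X n) (Y n);
  sfh_nat : forall m n (f : deltaHom m n),
    sfh_fun m \o sf_map X f =1 sf_map Y f \o sfh_fun n
}.

Lemma sFiltHom_ext (X Y : sFilt) (f g : sFiltHom X Y) :
  (forall n, f n =1 g n) -> f = g.
Proof.
case: f g => f fc [g gc] /= fg.
have {}fg : f = g by apply: functional_extensionality_dep => n; exact/filtHom_ext.
by rewrite fg in fc *; congr SFiltHom; exact: Prop_irrelevance.
Qed.

Lemma sfilt_comp_nat (X Y Z : sFilt) (g : sFiltHom Y Z) (f : sFiltHom X Y)
    m n (d : deltaHom m n) :
  filt_comp (g m) (f m) \o sf_map X d =1 sf_map Z d \o filt_comp (g n) (f n).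
Proof.
move=> x /=.
have /= -> := sfh_nat f d x.
by have /= -> := sfh_nat g d (f n x).
Qed.

Definition sfilt_comp (X Y Z : sFilt) (g : sFiltHom Y Z) (f : sFiltHom X Y) :
  sFiltHom X Z :=
  @SFiltHom X Z (fun n => filt_comp (g n) (f n)) (sfilt_comp_nat g f).

(* The points of 'I_n.+2 are the new minimal element ord0 and the points
   lift ord0 i of the original order; [consf x0 x] is x0 at the former and
   x i at the latter. *)
Definition consf (T : Type) (n : nat) (x0 : T) (x : 'I_n.+1 -> T) :
  'I_n.+2 -> T :=
  fun j => if unlift ord0 j is Some i then x i else x0.

Lemma delta_shift_homo m n (f : deltaHom m n) (i j : 'I_m.+2) : (i <= j)%N ->
  (consf ord0 (fun k => lift ord0 (f k)) i <=
   consf ord0 (fun k => lift ord0 (f k)) j)%N.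
Proof.
rewrite /consf; case: (unliftP ord0 i) => [i'|] -> //.
case: (unliftP ord0 j) => [j'|] -> //= ij.
by rewrite leq_add2l (delta_homo f).
Qed.

(* The functor [+1] : Delta -> Delta on morphisms; on objects it is n |-> n.+1. *)
Definition delta_shift (m n : nat) (f : deltaHom m n) : deltaHom m.+1 n.+1 :=
  @DeltaHom m.+1 n.+1 (consf ord0 (fun k => lift ord0 (f k)))
    (delta_shift_homo f).

Lemma delta_shift_id n : delta_shift (delta_id n) = delta_id n.+1.
Proof. by apply/deltaHom_ext => i; rewrite /= /consf; case: unliftP. Qed.

Lemma delta_shift_comp m n p (g : deltaHom n p) (f : deltaHom m n) :
  delta_shift (delta_comp g f) = delta_comp (delta_shift g) (delta_shift f).
Proof.
apply/deltaHom_ext => i; rewrite /= /consf.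
by case: (unliftP ord0 i) => [i'|] _ /=; rewrite ?liftK ?unlift_none.
Qed.

Lemma delta_new_homo n (i j : 'I_n.+1) : (i <= j)%N ->
  (lift ord0 i <= lift ord0 j)%N.
Proof. by move=> ij; rewrite /= leq_add2l. Qed.

(* The inclusion omitting the new minimal element. *)
Definition delta_new (n : nat) : deltaHom n n.+1 :=
  @DeltaHom n n.+1 (lift ord0) (@delta_new_homo n).

Lemma delta_new_nat m n (f : deltaHom m n) :
  delta_comp (delta_shift f) (delta_new m) = delta_comp (delta_new n) f.
Proof. by apply/deltaHom_ext => i; rewrite /= /consf liftK. Qed.

Lemma shift_map_id (X : sFilt) n :
  sf_map X (delta_shift (delta_id n)) =1 id.
Proof. by move=> x; rewrite delta_shift_id sf_map_id. Qed.

Lemma shift_map_comp (X : sFilt) m n p (g : deltaHom n p) (f : deltaHom m n) :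
  sf_map X (delta_shift (delta_comp g f)) =1
  sf_map X (delta_shift f) \o sf_map X (delta_shift g).
Proof. by move=> x; rewrite delta_shift_comp sf_map_comp. Qed.

(* X[+1] := X \o [+1]; it keeps the filters, so the level n of X[+1] is the
   level n.+1 of X. *)
Definition shift (X : sFilt) : sFilt :=
  @SFilt (fun n => X n.+1) (fun m n f => sf_map X (delta_shift f))
    (@shift_map_id X) (@shift_map_comp X).

Lemma unshift_nat (X : sFilt) m n (f : deltaHom m n) :
  sf_map X (delta_new m) \o sf_map (shift X) f =1
  sf_map X f \o sf_map X (delta_new n).
Proof.
move=> x; have /= <- := sf_map_comp (delta_shift f) (delta_new m) x.
by rewrite delta_new_nat sf_map_comp.
Qed.

(* The morphism [-1] : X[+1] -> X. *)
Definition unshift (X : sFilt) : sFiltHom (shift X) X :=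
  @SFiltHom (shift X) X (fun n => sf_map X (delta_new n)) (@unshift_nat X).

(* The simplicial set n_<= |-> Hom_Sets(n, T) = T^n with given filters. *)
Definition rep_sFilt (T : Type) (F : forall n, set_system ('I_n.+1 -> T))
    (FF : forall n, Filter (F n))
    (F_comp : forall m n (f : deltaHom m n) (A : set ('I_m.+1 -> T)),
      F m A -> F n [set x : 'I_n.+1 -> T | A (x \o f)]) : sFilt :=
  @SFilt (fun n => Filt (FF n))
    (fun m n f =>
       @FiltHom (Filt (FF n)) (Filt (FF m)) (fun x => x \o f) (@F_comp m n f))
    (fun _ _ => erefl) (fun _ _ _ _ _ _ => erefl).

Definition metric_nbhs (R : realType) (M : metricType R) (n : nat) :
  set_system ('I_n.+1 -> M) :=
  [set A | exists e : R, 0 < e /\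
     forall x : 'I_n.+1 -> M, (forall i j, mdist (x i) (x j) < e) -> A x].

Lemma metric_nbhs_filter (R : realType) (M : metricType R) (n : nat) :
  Filter (@metric_nbhs R M n).
Proof.
split.
- by exists 1; split.
- move=> A B [e [e0 eA]] [d [d0 dB]]; exists (Num.min e d).
  split=> [|x xed]; first by rewrite lt_min e0.
  by split; [apply: eA|apply: dB] => i j; have := xed i j;
    rewrite lt_min => /andP[].
- by move=> A B AB [e [e0 eA]]; exists e; split=> // x /eA /AB.
Qed.

Lemma metric_nbhs_comp (R : realType) (M : metricType R) m n
    (f : deltaHom m n) (A : set ('I_m.+1 -> M)) :
  metric_nbhs A -> metric_nbhs [set x : 'I_n.+1 -> M | A (x \o f)].
Proof.
by move=> [e [e0 eA]]; exists e; split=> // x xe; apply: eA => i j; exact: xe.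
Qed.

(* The simplicial filter M_u of a metric space M. *)
Definition metric_sFilt (R : realType) (M : metricType R) : sFilt :=
  rep_sFilt (@metric_nbhs_filter R M) (@metric_nbhs_comp R M).

Definition cof_nbhs (n : nat) : set_system ('I_n.+1 -> nat) :=
  [set A | exists N : nat,
     forall i : 'I_n.+1 -> nat, (forall k, (N < i k)%N) -> A i].

Lemma cof_nbhs_filter (n : nat) : Filter (@cof_nbhs n).
Proof.
split.
- by exists 0%N.
- move=> A B [N NA] [N' NB]; exists (maxn N N') => i iN.
  by split; [apply: NA|apply: NB] => k; have := iN k;
    rewrite gtn_max => /andP[].
- by move=> A B AB [N NA]; exists N => i /NA /AB.
Qed.

Lemma cof_nbhs_comp m n (f : deltaHom m n) (A : set ('I_m.+1 -> nat)) :
  cof_nbhs A -> cof_nbhs [set i : 'I_n.+1 -> nat | A (i \o f)].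
Proof. by move=> [N NA]; exists N => i iN; apply: NA => k; exact: iN. Qed.

(* The simplicial filter N^bullet_cof of Cartesian powers of the cofinite
   filter on nat. *)
Definition cof_sFilt : sFilt := rep_sFilt cof_nbhs_filter cof_nbhs_comp.

(* Main.v *)
(* The level-n component of a lift [ainf] of [abar] to the shift is
   i |-> (h_n i, a_{i_0}, ..., a_{i_n}). Naturality along the two maps 'I_1 -> 'I_2
   gives h_0 p = h_1 (p, q) = h_0 q, so h_0 is a constant l; naturality
   along any 'I_1 -> 'I_n.+1 then gives h_n = l. Continuity at level 0 says
   exactly that (l, a_p) is eventually close, i.e. that a converges to l. *)
Require Import Defs.
From mathcomp Require Import all_boot all_order all_algebra.
From mathcomp Require Import all_classical all_reals topology.

Set Implicit Arguments.
Unset Strict Implicit.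
Unset Printing Implicit Defensive.

Local Open Scope classical_set_scope.
Local Open Scope ring_scope.

Import Order.TTheory GRing.Theory Num.Theory.
Import metricType_numDomainType.

Section MetricSequences.
Variables (R : realType) (M : metricType R).
Implicit Types (a : nat -> M) (l : M).

(** The threshold is put in the strict form [N < n] used by [cof_nbhs]; passing from the large bound
    of [\oo] costs one successor. *)
Lemma cvg_mdistP a l : a @ \oo --> l <->
  forall e : R, 0 < e ->
    exists N, forall n, (N < n)%N -> mdist l (a n) < e.
Proof.
rewrite cvgrPdist_lt; split=> al e /al [N].
  by move=> _ Na; exists N => n /ltnW; exact: Na.
by move=> Na; exists N.+1.
Qed.

Lemma cauchy_mdistP a : cauchy (a @ \oo) <->
  forall e : R, 0 < e -> exists N, forall m n, (N < m)%N -> (N < n)%N ->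
    mdist (a m) (a n) < e.
Proof.
split=> [/cauchyP ca e e0|ca].
  have [x [N _ Nx]] := ca _ (divr_gt0 e0 (ltr0n _ 2)).
  have {}Nx n : (N < n)%N -> mdist x (a n) < e / 2.
    by move=> /ltnW /Nx; rewrite /= ballEmdist.
  exists N => m n /Nx xm /Nx xn; rewrite (splitr e).
  by apply: le_lt_trans (metric_triangle _ x _) _; rewrite metric_sym ltrD.
(* [N.+1] is the first index beyond the strict threshold, so [a N.+1] can serve as the centre of the
   ball. *)
apply/cauchyP => e /ca [N Na]; exists (a N.+1); exists N.+1 => // n Nn.
by rewrite /= ballEmdist /=; exact: Na.
Qed.

(** All entries of [consf l x], the new entry [l] included, lie within [e / 2] of [l]; the triangle
    inequality through [l] concludes. This gives the continuity of the lift built from a limit. *)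
Lemma mdist_consf (e : R) l n (x : 'I_n.+1 -> M) : 0 < e ->
  (forall i, mdist l (x i) < e / 2) ->
  forall i j, mdist (consf l x i) (consf l x j) < e.
Proof.
move=> e0 lx i j; have lc k : mdist l (consf l x k) < e / 2.
  rewrite /consf; case: unliftP => [k' _|_]; first exact: lx.
  by rewrite mdistxx divr_gt0.
rewrite (splitr e); apply: le_lt_trans (metric_triangle _ l _) _.
by rewrite metric_sym ltrD.
Qed.

End MetricSequences.

(** This is the naturality of adjoining [l]: [delta_shift f] fixes [ord0] and acts as [f] on the
    other points. *)
Lemma consf_comp (T : Type) m n (l : T) (x : 'I_n.+1 -> T)
    (f : deltaHom m n) :
  consf l (x \o f) = consf l x \o delta_shift f.
Proof.
apply/funext => j; rewrite /= /consf.
by case: (unliftP ord0 j) => [k|] _; rewrite ?liftK ?unlift_none.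
Qed.

Lemma consf_eta (T : Type) n (x : 'I_n.+2 -> T) :
  x = consf (x ord0) (x \o lift ord0).
Proof.
by apply/funext => j; rewrite /consf; case: (unliftP ord0 j) => [k|] ->.
Qed.

Lemma delta_const_homo m n (k : 'I_n.+1) (i j : 'I_m.+1) :
  (i <= j)%N -> (k <= k)%N.
Proof. by []. Qed.

Definition delta_const m n (k : 'I_n.+1) : deltaHom m n :=
  @DeltaHom m n (fun=> k) (delta_const_homo k).

Section Lifts.
Variables (R : realType) (M : metricType R) (a : nat -> M).

Lemma cauchy_sFiltHom : cauchy (a @ \oo) ->
  exists abar : sFiltHom cof_sFilt (metric_sFilt M),
    forall n (i : 'I_n.+1 -> nat), abar n i = (fun k => a (i k)).
Proof.
move=> /cauchy_mdistP ca.
have cont n (A : set ('I_n.+1 -> M)) : metric_nbhs A ->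
    cof_nbhs ((fun i : 'I_n.+1 -> nat => a \o i) @^-1` A).
  move=> [e [/ca [N Na] eA]]; exists N => i Ni.
  by apply: eA => j k; exact: Na.
pose abar n := @FiltHom (cof_sFilt n) (metric_sFilt M n) _ (cont n).
by exists (@SFiltHom cof_sFilt (metric_sFilt M) abar (fun _ _ _ _ => erefl)).
Qed.

(** The Cauchy condition is read off from continuity at level 1, that is, on pairs of indices. *)
Lemma sFiltHom_cauchy (abar : sFiltHom cof_sFilt (metric_sFilt M)) :
  (forall n (i : 'I_n.+1 -> nat), abar n i = (fun k => a (i k))) ->
  cauchy (a @ \oo).
Proof.
move=> abarE; apply/cauchy_mdistP => e e0.
have := @filtHom_cont _ _ (abar 1%N)
  [set x : 'I_2 -> M | mdist (x ord0) (x ord_max) < e].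
case=> [|N NA]; first by exists e; split=> // x; exact.
exists N => m n Nm Nn.
have /= := NA (fun k : 'I_2 => if k == ord0 then m else n).
by rewrite abarE; apply=> k; case: ifP.
Qed.

Lemma cvg_lift l : a @ \oo --> l ->
  exists ainf : sFiltHom cof_sFilt (shift (metric_sFilt M)),
    forall n (i : 'I_n.+1 -> nat), ainf n i = consf l (fun k => a (i k)).
Proof.
move=> /cvg_mdistP al.
have cont n (A : set ('I_n.+2 -> M)) : metric_nbhs A ->
    cof_nbhs ((fun i : 'I_n.+1 -> nat => consf l (a \o i)) @^-1` A).
  move=> [e [e0 eA]]; have [N Na] := al _ (divr_gt0 e0 (ltr0n _ 2)).
  by exists N => i Ni; apply: eA; apply: mdist_consf => // k; exact: Na.
pose ainf n := @FiltHom (cof_sFilt n) (shift (metric_sFilt M) n) _ (cont n).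
suff nat_ainf m n (f : deltaHom m n) :
    ainf m \o sf_map cof_sFilt f =1
    sf_map (shift (metric_sFilt M)) f \o ainf n.
  by exists (@SFiltHom cof_sFilt (shift (metric_sFilt M)) ainf nat_ainf).
by move=> i; exact: (consf_comp l (a \o i) f).
Qed.

Lemma lift_cst (ainf : sFiltHom cof_sFilt (shift (metric_sFilt M))) :
  exists l : M, forall n (i : 'I_n.+1 -> nat), ainf n i ord0 = l.
Proof.
(* Since [delta_shift f] fixes the new minimal element, the structure maps of the shift preserve the
   coordinate at [ord0]. *)
have head m n (f : deltaHom m n) (i : 'I_n.+1 -> nat) :
    ainf m (i \o f) ord0 = ainf n i ord0.
  have /= -> := sfh_nat ainf f i.
  by rewrite /= /consf unlift_none.
pose h p := ainf 0%N (fun=> p) ord0.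
have hE n (i : 'I_n.+1 -> nat) k : h (i k) = ainf n i ord0.
  exact: head (delta_const 0 k) i.
have h_cst p q : h p = h q.
  pose pq (k : 'I_2) := if k == ord0 then p else q.
  by rewrite -[p]/(pq ord0) -[q]/(pq ord_max) !hE.
by exists (h 0%N) => n i; rewrite -(hE n i ord0); exact: h_cst.
Qed.

Lemma lift_cvg (ainf : sFiltHom cof_sFilt (shift (metric_sFilt M))) :
  (forall n (i : 'I_n.+1 -> nat), ainf n i \o lift ord0 = (fun k => a (i k))) ->
  exists l : M, a @ \oo --> l /\
    forall n (i : 'I_n.+1 -> nat), ainf n i = consf l (fun k => a (i k)).
Proof.
move=> ainf_tail; have [l ainf_head] := lift_cst ainf.
have ainfE n (i : 'I_n.+1 -> nat) : ainf n i = consf l (fun k => a (i k)).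
  by rewrite -(ainf_head n i) -ainf_tail; exact: consf_eta.
exists l; split=> //; apply/cvg_mdistP => e e0.
(* Level 0 of the shift is level 1 of the metric object, so its neighbourhoods consist of pairs,
   here [(l, a n)]. *)
have := @filtHom_cont _ _ (ainf 0%N)
  [set x : 'I_2 -> M | mdist (x ord0) (x (lift ord0 ord0)) < e].
case=> [|N NA]; first by exists e; split=> // x; exact.
exists N => n Nn; have /= := NA (fun=> n) (fun=> Nn).
by rewrite ainfE /consf unlift_none liftK.
Qed.

End Lifts.

Theorem mainTheorem2 (R : realType) (M : metricType R) (a : nat -> M) :
  (cauchy (a @ \oo) <->
   exists abar : sFiltHom cof_sFilt (metric_sFilt M),
     forall (n : nat) (i : 'I_n.+1 -> nat), abar n i = (fun k => a (i k)))
  /\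
  (cauchy (a @ \oo) ->
   forall abar : sFiltHom cof_sFilt (metric_sFilt M),
   (forall (n : nat) (i : 'I_n.+1 -> nat), abar n i = (fun k => a (i k))) ->
   ((exists l : M, a @ \oo --> l) <->
    exists ainf : sFiltHom cof_sFilt (shift (metric_sFilt M)),
      abar = sfilt_comp (unshift (metric_sFilt M)) ainf)
   /\
   (forall ainf : sFiltHom cof_sFilt (shift (metric_sFilt M)),
      abar = sfilt_comp (unshift (metric_sFilt M)) ainf ->
      exists l : M, a @ \oo --> l /\
        forall (n : nat) (i : 'I_n.+1 -> nat),
          ainf n i = consf l (fun k => a (i k)))).
Proof.
split.
  split=> [|[abar abarE]]; first exact: cauchy_sFiltHom.
  exact: sFiltHom_cauchy abarE.
move=> _ abar abarE.
(* Composing with [unshift] deletes the coordinate at [ord0], so the factorisation is the hypothesis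
   of [lift_cvg]. The result serves both the converse implication and the final uniqueness claim. *)
have lift_of (ainf : sFiltHom cof_sFilt (shift (metric_sFilt M))) :
    abar = sfilt_comp (unshift (metric_sFilt M)) ainf ->
    exists l : M, a @ \oo --> l /\
      forall n (i : 'I_n.+1 -> nat), ainf n i = consf l (fun k => a (i k)).
  by move=> abar_ainf; apply: lift_cvg => n i; rewrite -abarE abar_ainf.
split=> //; split=> [[l /cvg_lift [ainf ainfE]]|[ainf /lift_of [l [al _]]]].
  exists ainf; apply: sFiltHom_ext => n i.
  rewrite abarE /= ainfE; apply/funext => k.
  by rewrite /= /consf liftK.
by exists l.
Qed.
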